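(* Each of the following sets of probability measures is path connected in the weak topology: the set of negatively correlated probability measures on the Boolean cube $\{0,1\}^n$; the set of negatively associated probability measures on $\{0,1\}^n$; the set of negatively correlated probability measures on $\mathbb{R}^n$; the set of negatively associated probability measures on $\mathbb{R}^n$.
   Context: A Borel probability measure $\mu$ on $\mathbb{R}^n$ is negatively correlated (NC) if $\int x_ix_j\,d\mu(x)\le\int x_i\,d\mu(x)\int x_j\,d\mu(x)$ for all $1\le i\ne j\le n$ (the integrals being understood to exist). A function $f:\mathbb{R}^m\to\mathbb{R}$ is non-decreasing if $f(x)\ge f(y)$ whenever $x\ge y$ coordinatewise. For $I\subset\{1,\dots,n\}$, $x_I\in\mathbb{R}^{|I|}$ is the restriction of $x$ to the coordinates in $I$. $\mu$ is negatively associated (NA) if for all disjoint $I,J\subset\{1,\dots,n\}$ and all non-decreasing integrable $f:\mathbb{R}^{|I|}\to\mathbb{R}$, $g:\mathbb{R}^{|J|}\to\mathbb{R}$, $$\int f(x_I)g(x_J)\,d\mu(x)\le\int f(x_I)\,d\mu(x)\int g(x_J)\,d\mu(x).$$ NC and NA measures on $\{0,1\}^n$ are those NC, respectively NA, measures on $\mathbb{R}^n$ that are concentrated on $\{0,1\}^n$. The weak topology is the weakest topology making $\mu\mapsto\int f\,d\mu$ continuous for every continuous $f:\mathbb{R}^n\to\mathbb{R}$ vanishing at infinity; on probability measures it is the topology of convergence in distribution. Each set carries the subspace topology. *)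

(* Defs.v *)
From HB Require Import structures.
From mathcomp Require Import all_boot all_order all_algebra.
From mathcomp Require Import all_classical all_reals all_analysis.

Set Implicit Arguments.
Unset Strict Implicit.
Unset Printing Implicit Defensive.

Import Order.TTheory GRing.Theory Num.Theory.
Import numFieldNormedType.Exports.

Local Open Scope classical_set_scope.
Local Open Scope ring_scope.

(* [R^n] with its Borel sigma-algebra; its underlying type is ['rV[R]_n]. *)
Definition borelRn (R : realType) (n : nat) : measurableType _ :=
  g_sigma_algebraType (@open 'rV[R]_n).

Definition vanishing_at_infinity (R : realType) (T : topologicalType)
    (f : T -> R) : Prop :=
  forall e : R, 0 < e ->
    exists2 K : set T, compact K & forall x, ~ K x -> `|f x| < e.

Definition C0Rn (R : realType) (n : nat) : Type :=
  {f : 'rV[R]_n -> R | continuous f /\ vanishing_at_infinity f}.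

(* The Borel probability measures on [R^n], with the weakest topology for which
   [mu |-> \int f dmu] is continuous for every [f] in [C0Rn R n]: the supremum
   of the initial topologies of these maps. The integrals are the real-valued
   ones ([Rintegral]); every such [f] is bounded, hence integrable. *)
Definition weak_probability (R : realType) (n : nat) : topologicalType :=
  sup_topology (fun f : C0Rn R n =>
    Topological.on (initial_topology
      (fun mu : probability (borelRn R n) R => \int[mu]_x sval f x : R))).

Section notions.
Variables (R : realType) (n : nat).

Definition negatively_correlated : set (weak_probability R n) :=
  [set mu : probability (borelRn R n) R |
    forall i j : 'I_n, i != j ->
      [/\ mu.-integrable setT (fun x : borelRn R n => (x 0 i)%:E),
          mu.-integrable setT (fun x : borelRn R n => (x 0 j)%:E),
          mu.-integrable setT (fun x : borelRn R n => (x 0 i * x 0 j)%:E) &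
          (\int[mu]_x (x 0 i * x 0 j)%:E
             <= \int[mu]_x (x 0 i)%:E * \int[mu]_x (x 0 j)%:E)%E]].

Definition coord_restr (I : {set 'I_n}) (x : 'rV[R]_n) : 'rV[R]_#|I| :=
  \row_(k < #|I|) x 0 (enum_val k).

Definition coord_nondecreasing (m : nat) (f : 'rV[R]_m -> R) : Prop :=
  forall x y : 'rV[R]_m, (forall k, y 0 k <= x 0 k) -> f y <= f x.

(* The integral of the product is taken in [\bar R], since the product of two
   integrable functions need not be integrable. When the inequality holds for
   all bounded [f] and [g], truncation shows that the positive part of the
   product has a finite integral, so that the left-hand side below is either
   finite or a genuine [-oo]; thus requiring in addition the product to be
   integrable before asking for the inequality defines the same measures. *)
Definition negatively_associated : set (weak_probability R n) :=
  [set mu : probability (borelRn R n) R |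
    forall (I J : {set 'I_n}) (f : 'rV[R]_#|I| -> R) (g : 'rV[R]_#|J| -> R),
      [disjoint I & J]%bool ->
      coord_nondecreasing f -> coord_nondecreasing g ->
      mu.-integrable setT
        (fun x : borelRn R n => (f (coord_restr I x))%:E) ->
      mu.-integrable setT
        (fun x : borelRn R n => (g (coord_restr J x))%:E) ->
      (\int[mu]_x (f (coord_restr I x) * g (coord_restr J x))%:E
         <= \int[mu]_x (f (coord_restr I x))%:E
            * \int[mu]_x (g (coord_restr J x))%:E)%E].

Definition boolean_cube : set 'rV[R]_n :=
  [set x | forall i, x 0 i = 0 \/ x 0 i = 1].

Definition on_boolean_cube : set (weak_probability R n) :=
  [set mu : probability (borelRn R n) R | mu boolean_cube = 1%E].

End notions.

(* The values of the path outside [`[0, 1]] are irrelevant. *)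
Definition path_connected (R : realType) (T : topologicalType) : Prop :=
  [set: T] !=set0 /\
  forall x y : T, exists p : R -> T,
    [/\ {within `[0, 1], continuous p}, p 0 = x & p 1 = y].

(* Main.v *)
Require Import Defs.
From HB Require Import structures.
From mathcomp Require Import all_boot all_order all_algebra.
From mathcomp Require Import all_classical all_reals all_analysis.
From mathcomp Require Import measurable_realfun ring.

(** Everything is joined to the Dirac mass at the origin by zeroing the
coordinates one after the other. For a measure [P] and a coordinate [k], let
[Q] be the image of [P] under the map [zeroing k] that replaces the [k]-th
coordinate by [0], and consider the segment of mixtures [t P + (1 - t) Q].
Equivalently, the [k]-th coordinate is multiplied by an independent Bernoulli
variable of parameter [t].

Although the sets are not convex in general, such a segment stays in the set it
starts from. Both notions of negative dependence bound the covariance of pairs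
[(u, v)], where [u] and [v] depend on disjoint sets of coordinates. Hence one of
the two, say [v], ignores the [k]-th coordinate and has the same integral [b]
under [P] and [Q], so that
<<
  E_t(u v) = t E_P(u v) + (1 - t) E_Q(u v)
           <= t E_P(u) b + (1 - t) E_Q(u) b = E_t(u) E_t(v) >>
([cov_le0_mixture]). The inequality under [Q] is the one of [P] for the pair
[(u \o zeroing k, v)], which is of the same kind: if [u] is a coordinate, it is
left unchanged or becomes [0], and if [u] is non-decreasing, it remains so. The
cube is stable because [zeroing k] maps it to itself.

A segment of measures is weakly continuous, since integrals along it are affine
in [t]. Concatenating the segments for all the coordinates [k] leads from [P] to
its image under the constant map [0], that is to the Dirac mass at [0]
([zeroing_stable_path_connected]), which lies in all four sets. *)

Set Implicit Arguments.
Unset Strict Implicit.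
Unset Printing Implicit Defensive.

Import Order.TTheory GRing.Theory Num.Theory.
Import numFieldNormedType.Exports.

Local Open Scope classical_set_scope.
Local Open Scope ring_scope.

(** * Mixtures of two probability measures *)

(** Equality as bundled structures, needed because the endpoints of a path in a
space of measures are compared by Leibniz equality; every field besides the
function is a proof. *)
Lemma eq_probability d (T : measurableType d) (R : realType)
  (P Q : probability T R) : P = Q :> (set T -> \bar R) -> P = Q.
Proof.
move: P Q => [P [a b c e f g h]] [Q [a' b' c' e' f' g' h']] /= PQ; subst Q.
have Ea : a = a'.
  case: a a' {b b'} => [p q] [p' q'].
  by rewrite (Prop_irrelevance p p') (Prop_irrelevance q q').
subst a'.
have -> : b = b' by case: b b' => [p] [p']; rewrite (Prop_irrelevance p p').
have -> : c = c' by case: c c' => [p] [p']; rewrite (Prop_irrelevance p p').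
have -> : e = e' by case: e e' => [p] [p']; rewrite (Prop_irrelevance p p').
have -> : f = f' by case: f f' => [p] [p']; rewrite (Prop_irrelevance p p').
have -> : g = g' by case: g g' => [p] [p']; rewrite (Prop_irrelevance p p').
by have -> : h = h' by case: h h' => [p] [p']; rewrite (Prop_irrelevance p p').
Qed.

Section mixture.
Local Open Scope ereal_scope.
Context d (T : measurableType d) (R : realType).
Context (t : {i01 R}) (P Q : probability T R).

Definition mixture := measure_add
  (mscale (t%:num%:nng)%R P) (mscale ((1 - t%:num)%:nng)%R Q).

HB.instance Definition _ := Measure.on mixture.

Lemma mixtureE A : mixture A = t%:num%:E * P A + (1 - t%:num)%:E * Q A.
Proof. exact: measure_addE. Qed.

Let mixture_setT : mixture setT = 1.
Proof.
rewrite mixtureE [P _]probability_setT [Q _]probability_setT !mule1.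
by rewrite -EFinD addrC subrK.
Qed.

HB.instance Definition _ :=
  Measure_isProbability.Build _ _ _ mixture mixture_setT.

Let ge0_integral_mixture (h : T -> \bar R) : measurable_fun setT h ->
  (forall x, 0 <= h x) ->
  \int[mixture]_x h x =
  t%:num%:E * \int[P]_x h x + (1 - t%:num)%:E * \int[Q]_x h x.
Proof.
move=> mh h0.
by rewrite ge0_integral_measure_add// !ge0_integral_mscale.
Qed.

Let ge0_muleB (c a b : \bar R) :
  c \is a fin_num -> 0 <= c -> 0 <= a -> 0 <= b -> c * (a - b) = c * a - c * b.
Proof.
move: c => [c||]// _; rewrite le_eqVlt => /predU1P[<-|c0].
  by rewrite !mul0e subee.
move: a b => [a||] [b||]//= _ _; rewrite ?(gt0_muley, gt0_muleNy)//.
by rewrite -EFinB -!EFinM -EFinB mulrBr.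
Qed.

Let ge0_addeBB (a b a' b' : \bar R) :
  0 <= a -> 0 <= b -> 0 <= a' -> 0 <= b' ->
  (a + b) - (a' + b') = (a - a') + (b - b').
Proof.
move: a b a' b' => [a||] [b||] [a'||] [b'||] //= _ _ _ _.
by rewrite -?EFinN -!EFinD opprD addrACA.
Qed.

(** Integrability is not assumed: since [-oo] absorbs [+oo] in a sum, the
integral of a function whose positive and negative parts both have an infinite
integral is [-oo], and the formula still holds. This matters for the product of
two integrable functions, which need not be integrable. *)
Lemma integral_mixture (h : T -> \bar R) : measurable_fun setT h ->
  \int[mixture]_x h x =
  t%:num%:E * \int[P]_x h x + (1 - t%:num)%:E * \int[Q]_x h x.
Proof.
move=> mh; rewrite integralE [in RHS]integralE [X in _ + _ * X]integralE.
have [mp mn] := (measurable_funepos mh, measurable_funeneg mh).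
rewrite !ge0_integral_mixture//.
have I0 (m : probability T R) g : (forall x, 0 <= g x) -> 0 <= \int[m]_x g x.
  by move=> g0; apply: integral_ge0.
have aff (a b a' b' : \bar R) : 0 <= a -> 0 <= b -> 0 <= a' -> 0 <= b' ->
    (t%:num%:E * a + (1 - t%:num)%:E * b) -
    (t%:num%:E * a' + (1 - t%:num)%:E * b') =
    t%:num%:E * (a - a') + (1 - t%:num)%:E * (b - b').
  by move=> *; rewrite !ge0_muleB ?ge0_addeBB ?mule_ge0 ?lee_fin.
exact: (aff _ _ _ _ (I0 _ _ (funepos_ge0 h)) (I0 _ _ (funepos_ge0 h))
                    (I0 _ _ (funeneg_ge0 h)) (I0 _ _ (funeneg_ge0 h))).
Qed.

Lemma integrable_mixture (h : T -> \bar R) :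
  P.-integrable setT h -> Q.-integrable setT h -> mixture.-integrable setT h.
Proof.
move=> /integrableP[mh Ph] /integrableP[_ Qh]; apply/integrableP; split => //.
rewrite integral_mixture; last exact: measurableT_comp.
by rewrite lte_add_pinfty// lte_mul_pinfty ?lee_fin.
Qed.

Lemma mixture_integrable (h : T -> \bar R) : (0 < t%:num < 1)%R ->
  mixture.-integrable setT h -> P.-integrable setT h /\ Q.-integrable setT h.
Proof.
move=> /andP[t0 t1] /integrableP[mh].
rewrite integral_mixture; last exact: measurableT_comp.
have P0 : 0 <= \int[P]_x `|h x| by apply: integral_ge0.
have Q0 : 0 <= \int[Q]_x `|h x| by apply: integral_ge0.
move=> H; split; apply/integrableP; split => //; rewrite ltey;
  apply/eqP => E; move: H; rewrite E gt0_muley ?lte_fin ?subr_gt0//.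
- by rewrite addye// gt_eqF// (lt_le_trans (ltNyr 0))// mule_ge0// lee_fin
    subr_ge0 ltW.
- by rewrite addey// gt_eqF// (lt_le_trans (ltNyr 0))// mule_ge0// lee_fin ltW.
Qed.

End mixture.

Lemma mixture0 d (T : measurableType d) (R : realType) (t : {i01 R})
  (P Q : probability T R) : t%:num = 0 -> mixture t P Q = Q :> probability T R.
Proof.
move=> t0; apply: eq_probability; apply/funext => A.
by rewrite [LHS]mixtureE t0 mul0e add0e subr0 mul1e.
Qed.

Lemma mixture1 d (T : measurableType d) (R : realType) (t : {i01 R})
  (P Q : probability T R) : t%:num = 1 -> mixture t P Q = P :> probability T R.
Proof.
move=> t1; apply: eq_probability; apply/funext => A.
by rewrite [LHS]mixtureE t1 subrr mul0e adde0 mul1e.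
Qed.

(** * Nonpositive covariance *)

Section covariance.
Context d (T : measurableType d) (R : realType).
Implicit Types (P : probability T R) (u v : T -> R).
Local Open Scope ereal_scope.

Definition cov_le0 P u v :=
  \int[P]_x (u x * v x)%:E <= \int[P]_x (u x)%:E * \int[P]_x (v x)%:E.

Lemma cov_le0C P u v : cov_le0 P u v -> cov_le0 P v u.
Proof. by rewrite /cov_le0 muleC; under eq_integral do rewrite mulrC. Qed.

Lemma integral_distribution_measurable P (X : {mfun T >-> T})
    (h : T -> \bar R) :
  measurable_fun setT h -> \int[distribution P X]_x h x = \int[P]_x h (X x).
Proof.
move=> mh; rewrite integralE [RHS]integralE.
have [mp mn] := (measurable_funepos mh, measurable_funeneg mh).
rewrite !ge0_integral_distribution//.
by rewrite -(funepos_comp h X) -(funeneg_comp h X).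
Qed.

Lemma integrable_distribution P (X : {mfun T >-> T}) (h : T -> \bar R) :
  measurable_fun setT h ->
  (distribution P X).-integrable setT h <-> P.-integrable setT (h \o X).
Proof.
move=> mh; split => /integrableP[_ ih]; apply/integrableP; split => //.
- exact: measurableT_comp.
- move: ih; rewrite integral_distribution_measurable//.
  exact: measurableT_comp.
- by rewrite integral_distribution_measurable//; exact: measurableT_comp.
Qed.

Lemma cov_le0_distribution P (X : {mfun T >-> T}) u v :
  measurable_fun setT u -> measurable_fun setT v ->
  cov_le0 P (u \o X) (v \o X) -> cov_le0 (distribution P X) u v.
Proof.
move=> mu mv; rewrite /cov_le0 !integral_distribution_measurable//;
  apply/measurable_EFinP => //; exact: measurable_funM.
Qed.

(** As [v] has the same integral under [P] and under its image by [X], the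
product of the two integrals on the right-hand side of the covariance
inequality is affine in [t] instead of quadratic. *)
Lemma cov_le0_mixture (t : {i01 R}) P (X : {mfun T >-> T}) u v :
  v \o X = v ->
  P.-integrable setT (EFin \o u) -> P.-integrable setT (EFin \o (u \o X)) ->
  P.-integrable setT (EFin \o v) ->
  cov_le0 P u v -> cov_le0 P (u \o X) v ->
  cov_le0 (mixture t P (distribution P X)) u v.
Proof.
move=> vX iu iuX iv; rewrite /cov_le0 => uv uXv.
have [mu mv] : measurable_fun setT u /\ measurable_fun setT v.
  split; apply/measurable_EFinP; [exact: measurable_int iu|].
  exact: measurable_int iv.
have muv : measurable_fun setT (fun x => (u x * v x)%:E).
  by apply/measurable_EFinP; exact: measurable_funM.
rewrite !integral_mixture//; try exact/measurable_EFinP.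
rewrite !integral_distribution_measurable//; try exact/measurable_EFinP.
have vXE x : v (X x) = v x by rewrite -[in RHS]vX.
under [X in _ + _ * X <= _]eq_integral do rewrite vXE.
under [X in _ <= _ * (_ + _ * X)]eq_integral do rewrite vXE.
have fin w : P.-integrable setT (EFin \o w) ->
    \int[P]_x (w x)%:E = (\int[P]_x w x)%R%:E.
  by move=> iw; rewrite /Rintegral fineK//; exact: integrable_fin_num iw.
have := fin _ iuX; rewrite /= => IuX.
move: uv uXv; rewrite /= (fin _ iu) IuX (fin _ iv).
set a := Rintegral _ _ u; set b := Rintegral _ _ v; set a' := Rintegral _ _ _.
move=> uv uXv.
have -> : (t%:num%:E * a%:E + (1 - t%:num)%:E * a'%:E) *
    (t%:num%:E * b%:E + (1 - t%:num)%:E * b%:E) =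
    t%:num%:E * (a%:E * b%:E) + (1 - t%:num)%:E * (a'%:E * b%:E).
  by rewrite -!EFinM -!EFinD; congr EFin; ring.
by apply: leeD; apply: lee_wpmul2l => //; rewrite lee_fin.
Qed.

End covariance.

Section dirac.
Context d (T : measurableType d) (R : realType) (a : T).

Lemma integral_dirac_measurable (h : T -> \bar R) :
  measurable_fun setT h -> (\int[\d_a]_x h x = h a)%E.
Proof. by move=> mh; rewrite integral_dirac// diracT mul1e. Qed.

Lemma integrable_dirac (h : T -> R) : measurable_fun setT h ->
  (\d_a : probability T R).-integrable setT (EFin \o h).
Proof.
move=> /measurable_EFinP mh; apply/integrableP; split => //.
rewrite integral_dirac_measurable; last exact: measurableT_comp.
by rewrite /= ltry.
Qed.

Lemma cov_le0_dirac (u v : T -> R) :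
  measurable_fun setT u -> measurable_fun setT v ->
  cov_le0 (\d_a : probability T R) u v.
Proof.
move=> mu mv; rewrite /cov_le0 !integral_dirac_measurable//;
  apply/measurable_EFinP => //; exact: measurable_funM.
Qed.

End dirac.

(** * Paths in a topological space *)

Section joined.
Context (R : realType) (T : topologicalType).
Implicit Types x y z : T.

(** Continuity on the whole line, rather than on [`[0, 1]], lets paths be
reparametrized without tracking domains. *)
Definition joined x y :=
  exists p : R -> T, [/\ continuous p, p 0 = x & p 1 = y].

Lemma joined_refl x : joined x x.
Proof. by exists (fun=> x); split => // t; exact: cvg_cst. Qed.

Lemma joined_sym x y : joined x y -> joined y x.
Proof.
move=> [p [cp p0 p1]]; exists (fun t => p (1 - t)).
rewrite subr0 subrr; split => // t.
apply: (@continuous_comp _ _ _ (fun t : R => 1 - t) p); last exact: cp.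
by apply: cvgB; [exact: cvg_cst|exact: cvg_id].
Qed.

Lemma joined_trans x y z : joined x y -> joined y z -> joined x z.
Proof.
move=> [p [cp p0 p1]] [q [cq q0 q1]].
exists (fun t => if t <= 2^-1 then p (2 * t) else q (2 * t - 1)).
have h0 : (0 : R) < 2^-1 by rewrite invr_gt0.
have h1 : ((1 : R) <= 2^-1) = false by rewrite leNgt invf_lt1 ?ltr1n.
rewrite (ltW h0) h1 mulr0 mulr1 (_ : 2 - 1 = 1 :> R); last by ring.
split => //; apply/continuous_subspace_setT.
have -> : [set: R] = [set t | t <= 2^-1] `|` [set t | 2^-1 <= t].
  by apply/seteqP; split => // t _ /=; have [|/ltW] := leP t 2^-1; [left|right].
have cmul : continuous (fun t : R => 2 * t).
  by move=> t; apply: cvgM; [exact: cvg_cst|exact: cvg_id].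
apply: withinU_continuous; [exact: closed_le|exact: closed_ge| |].
- apply: (@subspace_eq_continuous _ _ _ (p \o ( *%R 2))).
    by move=> t; rewrite inE => th; rewrite /from_subspace /= ifT.
  apply: continuous_subspaceT => t.
  by apply: continuous_comp; [exact: cmul|exact: cp].
- apply: (@subspace_eq_continuous _ _ _ (q \o (fun t => 2 * t - 1))).
    move=> t; rewrite inE /from_subspace /= => t2; case: ifPn => //= t2'.
    have -> : t = 2^-1 by apply/le_anti/andP.
    by rewrite mulfV// subrr p1 q0.
  apply: continuous_subspaceT => t.
  apply: continuous_comp; last exact: cq.
  by apply: cvgB; [exact: cmul|exact: cvg_cst].
Qed.

Lemma path_connected_joined x0 : (forall x, joined x x0) -> path_connected R T.
Proof.
move=> x0P; split; first by exists x0.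
move=> x y; have [p [cp p0 p1]] := joined_trans (x0P x) (joined_sym (x0P y)).
by exists p; split => //; exact: continuous_subspaceT.
Qed.

End joined.

Lemma joined_set_type (R : realType) (T : topologicalType) (A : set T)
    (p : R -> T) (x y : set_type A) :
  continuous p -> (forall t, A (p t)) -> p 0 = val x -> p 1 = val y ->
  joined R x y.
Proof.
move=> cp Ap p0 p1; exists (fun t => SigSub (mem_set (Ap t)) : set_type A).
split; [|exact: val_inj|exact: val_inj].
by apply: continuous_comp_initial; rewrite set_valE.
Qed.

Section unit_clamp.
Context (R : realType).

Let clamp_ge0 (t : R) : 0 <= Num.max 0 (Num.min t 1).
Proof. by rewrite le_max lexx. Qed.

Let clamp_le1 (t : R) : Num.max 0 (Num.min t 1) <= 1.
Proof. by rewrite ge_max ler01 ge_min lexx orbT. Qed.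

(** The retraction of the line onto the unit interval, which turns a segment of
mixtures into a path defined on the whole line. *)
Definition unit_clamp (t : R) : {i01 R} := Itv01 (clamp_ge0 t) (clamp_le1 t).

Lemma unit_clamp0 : (unit_clamp 0)%:num = 0 :> R.
Proof. by rewrite /= max_l// ge_min lexx. Qed.

Lemma unit_clamp1 : (unit_clamp 1)%:num = 1 :> R.
Proof. by rewrite /= min_l// max_r. Qed.

Lemma unit_clamp_continuous : continuous (fun t => (unit_clamp t)%:num : R).
Proof.
move=> t; apply: (@continuous_max _ _ (fun=> 0) (fun t : R => Num.min t 1)).
  exact: cvg_cst.
by apply: (@continuous_min _ _ id (fun=> 1)); [exact: cvg_id|exact: cvg_cst].
Qed.

End unit_clamp.

(** * Segments in the weak topology *)

Section weak.
Context (R : realType) (n : nat).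
Local Notation M := (weak_probability R n).
Local Notation T := (borelRn R n).

Lemma continuous_borel_measurable (f : 'rV[R]_n -> R) :
  continuous f -> measurable_fun setT (f : T -> R).
Proof.
move=> /continuousP cf; apply: (measurability _ (RGenOpens.measurableE R)).
move=> _ [_ [a [b ->]] <-]; rewrite setTI.
by apply: sub_sigma_algebra; apply: cf; exact: interval_open.
Qed.

Lemma C0_measurable (f : C0Rn R n) : measurable_fun setT (sval f : T -> R).
Proof. exact: continuous_borel_measurable (proj1 (svalP f)). Qed.

Lemma C0_bounded (f : C0Rn R n) : [bounded sval f x | x in setT].
Proof.
case: f => f [cf /(_ 1 ltr01) [K cK Kf]] /=.
have /compact_bounded[M [Mr hM]] : compact (f @` K).
  by apply: continuous_compact => //; exact: continuous_subspaceT.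
exists (Num.max M 1); split; first by rewrite num_real.
move=> N; rewrite gt_max => /andP[MN N1] x _ /=.
have [Kx|Kx] := pselect (K x); first by apply: (hM N MN); exists x.
by rewrite ltW// (lt_trans (Kf x Kx)).
Qed.

Lemma C0_integrable (P : probability T R) (f : C0Rn R n) :
  P.-integrable setT (EFin \o sval f).
Proof.
apply: measurable_bounded_integrable => //.
- exact: (le_lt_trans (probability_le1 P measurableT) (ltry 1)).
- exact: C0_measurable.
- exact: C0_bounded.
Qed.

Lemma continuous_weak (S : topologicalType) (p : S -> probability T R) :
  (forall f : C0Rn R n, continuous (fun s => \int[p s]_x sval f x : R)) ->
  continuous (p : S -> M).
Proof.
move=> cp s; apply/cvg_sup => f.
exact: (@continuous_comp_initial _ _ _ _ (p : S -> initial_topology _) (cp f)).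
Qed.

Lemma continuous_mixture (P Q : probability T R) :
  continuous (fun t => mixture (unit_clamp t) P Q : M).
Proof.
apply: continuous_weak => f.
pose a := \int[P]_x sval f x; pose b := \int[Q]_x sval f x.
rewrite (_ : (fun t => _) =
  fun t => (unit_clamp t)%:num * a + (1 - (unit_clamp t)%:num) * b).
  move=> t; apply: cvgD; apply: cvgM; try exact: cvg_cst.
    exact: unit_clamp_continuous.
  apply: cvgB; first exact: cvg_cst.
  exact: unit_clamp_continuous.
apply/funext => t; rewrite /Rintegral integral_mixture; last first.
  by apply/measurable_EFinP; exact: C0_measurable.
have Pf := integrable_fin_num measurableT (C0_integrable P f).
have Qf := integrable_fin_num measurableT (C0_integrable Q f).
by rewrite fineD ?fin_numM ?fineM//; do ?[exact: Pf|exact: Qf].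
Qed.

(** The identity: it makes the bundled measure visible to the inference of
structures, which does not see through [weak_probability]. *)
Definition to_prob (mu : M) : probability T R := mu.

Lemma joined_mixture (A : set M) (x y : set_type A) :
  (forall t : {i01 R}, A (mixture t (to_prob (val y)) (to_prob (val x)))) ->
  joined R x y.
Proof.
move=> AM.
apply: (joined_set_type (@continuous_mixture _ _)) => [t|/=|/=].
- exact: AM.
- by apply: mixture0; exact: unit_clamp0.
- by apply: mixture1; exact: unit_clamp1.
Qed.

End weak.

(** * Zeroing one coordinate after the other *)

Section zeroing.
Context (R : realType) (n : nat).
Local Notation T := (borelRn R n).
Implicit Types (P : probability T R) (A : set (weak_probability R n)).

Definition zeroing (k : 'I_n) (x : T) : T :=
  \row_i (if i == k then 0 else x 0 i).

Lemma zeroing_continuous k : continuous (zeroing k : 'rV[R]_n -> 'rV[R]_n).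
Proof.
move=> x s /= /(nbhs_ballP (zeroing k x)) [e e0 es].
apply/nbhs_ballP; exists e => //= y [_ xy]; apply: es; split => // i j.
by rewrite !mxE; case: ifP => _; [exact: ballxx|rewrite -(ord1 i); exact: xy].
Qed.

Lemma zeroing_measurable k : measurable_fun setT (zeroing k : T -> T).
Proof.
have /continuousP cz := @zeroing_continuous k.
apply: (@measurability _ _ T T setT _ (@open 'rV[R]_n) erefl).
by move=> _ [A oA <-]; rewrite setTI; apply: sub_sigma_algebra; exact: cz.
Qed.

HB.instance Definition _ k :=
  isMeasurableFun.Build _ _ T T (zeroing k) (zeroing_measurable k).

Definition zeroing_stable A := forall P k (t : {i01 R}),
  A P -> A (mixture t P (distribution P (zeroing k))).

Lemma zeroing_stableI A B :
  zeroing_stable A -> zeroing_stable B -> zeroing_stable (A `&` B).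
Proof. by move=> sA sB P k t [AP BP]; split; [exact: sA|exact: sB]. Qed.

Lemma foldl_zeroing (s : seq 'I_n) (x : T) i :
  foldl (fun y k => zeroing k y) x s 0 i = if i \in s then 0 else x 0 i.
Proof.
elim: s x => [//|k s IHs] x /=; rewrite IHs inE mxE.
by case: (i \in s); rewrite ?orbT ?orbF.
Qed.

Lemma foldl_zeroing_enum (x : T) :
  foldl (fun y k => zeroing k y) x (enum 'I_n) = 0.
Proof. by apply/rowP => i; rewrite foldl_zeroing mem_enum mxE. Qed.

Lemma joined_foldl_zeroing A (x : set_type A) (s : seq 'I_n) :
  zeroing_stable A ->
  exists2 y, joined R x y & forall B, to_prob (val y) B =
    to_prob (val x) [set z | B (foldl (fun y k => zeroing k y) z s)].
Proof.
move=> stA; elim: s x => [|k s IHs] x.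
  by exists x => //; exact: joined_refl.
have Ax : A (val x) by exact: set_valP.
pose P := to_prob (val x).
pose Q : probability T R := distribution P (zeroing k).
have AQ : A Q.
  have : A (mixture (unit_clamp 0) P Q) by exact: stA.
  by rewrite mixture0//; exact: unit_clamp0.
have [y Qy yE] := IHs (SigSub (mem_set AQ)).
exists y; last by move=> B; rewrite yE.
apply: joined_trans Qy; apply: joined_sym; apply: joined_mixture => t.
exact: stA.
Qed.

Lemma zeroing_stable_path_connected A :
  A (\d_(0 : T) : probability T R) -> zeroing_stable A ->
  path_connected R (set_type A).
Proof.
move=> A0 stA; pose x0 : set_type A := SigSub (mem_set A0).
apply: (path_connected_joined (x0 := x0)) => x.
have [y xy yE] := joined_foldl_zeroing x (enum 'I_n) stA.
suff -> : x0 = y by [].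
apply: val_inj; apply: eq_probability; apply/funext => B.
rewrite [RHS]yE /= diracE.
have -> : [set z | B (foldl (fun y k => zeroing k y) z (enum 'I_n))] =
    [set _ | B (0 : T)].
  by apply/funext => z; rewrite /= foldl_zeroing_enum.
have [B0|B0] := pselect (B (0 : T)).
  rewrite mem_set// (_ : [set _ | _] = setT); last by apply/seteqP; split=> z.
  by rewrite [RHS]probability_setT.
rewrite memNset// (_ : [set _ | _] = set0); last by apply/seteqP; split=> z.
by rewrite [RHS]measure0.
Qed.

End zeroing.

(** * The cube and negative correlation *)

Section cube_and_correlation.
Context (R : realType) (n : nat).
Local Notation T := (borelRn R n).
Local Notation delta0 := (\d_(0 : T) : probability T R).

Lemma coord_measurable (i : 'I_n) : measurable_fun setT (fun x : T => x 0 i).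
Proof. exact: continuous_borel_measurable (@coord_continuous R 1 n 0 i). Qed.

Lemma on_boolean_cube_dirac0 : @on_boolean_cube R n delta0.
Proof.
rewrite /on_boolean_cube /= diracE mem_set// => i.
by left; rewrite mxE.
Qed.

Lemma on_boolean_cube_stable : zeroing_stable (@on_boolean_cube R n).
Proof.
move=> P k t; rewrite /on_boolean_cube /= => P1.
have mc : measurable (@boolean_cube R n : set T).
  rewrite (_ : @boolean_cube R n = \bigcap_(i in setT)
      ((fun x : T => x 0 i) @^-1` [set 0; 1])); last first.
    by apply/seteqP; split => x h i; [move=> _|]; apply: h.
  apply: fin_bigcap_measurable => // i _; rewrite -[X in measurable X]setTI.
  by apply: coord_measurable => //; apply: measurableU.
have mpc := zeroing_measurable k measurableT mc; rewrite setTI in mpc.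
suff Pz1 : distribution P (zeroing k) (@boolean_cube R n) = 1%E.
  by rewrite mixtureE P1 [X in (_ + _ * X)%E]Pz1 !mule1 -EFinD addrC subrK.
apply/le_anti/andP; split; first exact: probability_le1.
rewrite -P1; apply: le_measure; rewrite ?inE// => x cx i.
by rewrite mxE; case: ifP => _; [left|exact: cx].
Qed.

Lemma negatively_correlated_dirac0 : @negatively_correlated R n delta0.
Proof.
move=> i j ij; have mc := coord_measurable.
split; try exact: integrable_dirac.
- by apply: integrable_dirac; exact: measurable_funM.
- exact: cov_le0_dirac.
Qed.

Lemma negatively_correlated_stable :
  zeroing_stable (@negatively_correlated R n).
Proof.
move=> P k t NC; pose Q := mixture t P (distribution P (zeroing k)).
(* At most one of [i] and [j] is [k]; by symmetry, not [j]. *)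
suff pair i j : i != j -> j != k ->
    [/\ Q.-integrable setT (fun x : T => (x 0 i)%:E),
        Q.-integrable setT (fun x : T => (x 0 j)%:E),
        Q.-integrable setT (fun x : T => (x 0 i * x 0 j)%:E) &
        cov_le0 Q (fun x : T => x 0 i) (fun x : T => x 0 j)].
  move=> i j ij; have [jk|jk] := eqVneq j k; last exact: pair.
  have [ji ik] : j != i /\ i != k by rewrite eq_sym ij -jk.
  have [Ij Ii Iji cji] := pair j i ji ik.
  split => //; last exact: cov_le0C.
  by under eq_fun do rewrite mulrC.
move=> ij jk; have [Ii Ij Iij cij] := NC i j ij.
have mc := coord_measurable.
have mE l : measurable_fun setT (fun x : T => (x 0 l)%:E).
  exact/measurable_EFinP.
have mEE : measurable_fun setT (fun x : T => (x 0 i * x 0 j)%:E).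
  by apply/measurable_EFinP; exact: measurable_funM.
have zj (x : T) : zeroing k x 0 j = x 0 j by rewrite mxE (negbTE jk).
have zi : (forall x : T, zeroing k x 0 i = 0) \/
    (forall x : T, zeroing k x 0 i = x 0 i).
  have [->|ik] := eqVneq i k; [left|right] => x;
    by rewrite mxE ?eqxx ?(negbTE ik).
have Iiz : P.-integrable setT (fun x : T => (zeroing k x 0 i)%:E).
  by case: zi => zi; under eq_fun do rewrite zi; [exact: integrable0|].
split.
- apply: integrable_mixture => //.
  by apply/integrable_distribution.
- apply: integrable_mixture => //; apply/integrable_distribution => //.
  by rewrite /comp; under eq_fun do rewrite zj.
- apply: integrable_mixture => //; apply/integrable_distribution => //.
  rewrite /comp; under eq_fun do rewrite zj.
  case: zi => zi; under eq_fun do rewrite zi; last by [].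
  by under eq_fun do rewrite mul0r; exact: integrable0.
- apply: cov_le0_mixture => //; first by apply/funext => x; exact: zj.
  case: zi => zi.
    rewrite (_ : _ \o _ = fun=> 0); last by apply/funext.
    rewrite /cov_le0 integral0 mul0e.
    by under eq_integral do rewrite mul0r; rewrite integral0.
  by rewrite (_ : _ \o _ = fun x : T => x 0 i)//; apply/funext.
Qed.

End cube_and_correlation.

(** * Negative association *)

Section association.
Context (R : realType) (n : nat).
Local Notation T := (borelRn R n).
Local Notation delta0 := (\d_(0 : T) : probability T R).
Implicit Types P : probability T R.

Lemma negatively_associated_dirac0 : @negatively_associated R n delta0.
Proof.
move=> I J f g _ _ _ fi gi; apply: cov_le0_dirac; apply/measurable_EFinP.
- exact: measurable_int fi.
- exact: measurable_int gi.
Qed.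

Lemma coord_nondecreasing_zeroing (I : {set 'I_n}) (f : 'rV[R]_#|I| -> R) k :
  coord_nondecreasing f -> exists2 g : 'rV[R]_#|I| -> R,
    coord_nondecreasing g &
    forall x, f (coord_restr I (zeroing k x)) = g (coord_restr I x).
Proof.
move=> fnd.
pose z (y : 'rV[R]_#|I|) : 'rV_#|I| :=
  \row_l if enum_val l == k then 0 else y 0 l.
exists (f \o z); last first.
  by move=> x; congr f; apply/rowP => l; rewrite !mxE.
move=> x y xy; apply: fnd => l; rewrite !mxE.
by case: ifP.
Qed.

Lemma coord_restr_zeroing (I : {set 'I_n}) k x :
  k \notin I -> coord_restr I (zeroing k x) = coord_restr I x :> 'rV[R]_#|I|.
Proof.
move=> kI; apply/rowP => l; rewrite !mxE; case: eqP => // lk.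
by move: kI; rewrite -lk enum_valP.
Qed.

Lemma negatively_associated_distribution P k :
  @negatively_associated R n P ->
  @negatively_associated R n (distribution P (zeroing k)).
Proof.
move=> NA I J f g IJ fnd gnd fi gi.
have mf : measurable_fun setT (fun x : T => f (coord_restr I x)).
  by apply/measurable_EFinP; exact: measurable_int fi.
have mg : measurable_fun setT (fun x : T => g (coord_restr J x)).
  by apply/measurable_EFinP; exact: measurable_int gi.
have [f' f'nd ff'] := coord_nondecreasing_zeroing k fnd.
have [g' g'nd gg'] := coord_nondecreasing_zeroing k gnd.
apply: cov_le0_distribution => //.
have -> : (fun x => f (coord_restr I x)) \o zeroing k =
    fun x => f' (coord_restr I x) by exact/funext.
have -> : (fun x => g (coord_restr J x)) \o zeroing k =
    fun x => g' (coord_restr J x) by exact/funext.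
apply: NA => //.
- have := (integrable_distribution P (zeroing k) (measurable_int _ fi)).1 fi.
  by rewrite /comp; under eq_fun do rewrite ff'.
- have := (integrable_distribution P (zeroing k) (measurable_int _ gi)).1 gi.
  by rewrite /comp; under eq_fun do rewrite gg'.
Qed.

(** The endpoints are treated apart: an integrable function for the mixture is
integrable for both components only when both weights are positive. *)
Lemma negatively_associated_stable :
  zeroing_stable (@negatively_associated R n).
Proof.
move=> P k t NA; have NAz := negatively_associated_distribution (k := k) NA.
have [t0|t0] := eqVneq t%:num (0 : R); first by rewrite mixture0.
have [t1|t1] := eqVneq t%:num (1 : R); first by rewrite mixture1.
have t01 : 0 < t%:num < (1 : R) by rewrite !lt_neqAle eq_sym t0 t1/= ge0 le1.
pose Q := mixture t P (distribution P (zeroing k)).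
(* [k] belongs to at most one of [I] and [J]; by symmetry, not to [J]. *)
suff pair (I J : {set 'I_n}) (f : 'rV[R]_#|I| -> R) (g : 'rV[R]_#|J| -> R) :
    [disjoint I & J]%bool -> k \notin J ->
    coord_nondecreasing f -> coord_nondecreasing g ->
    Q.-integrable setT (fun x : T => (f (coord_restr I x))%:E) ->
    Q.-integrable setT (fun x : T => (g (coord_restr J x))%:E) ->
    cov_le0 Q
      (fun x : T => f (coord_restr I x)) (fun x : T => g (coord_restr J x)).
  move=> I J f g IJ fnd gnd fi gi.
  have [kJ|kJ] := boolP (k \in J); last exact: pair.
  apply: cov_le0C; apply: pair => //; first by rewrite disjoint_sym.
  by rewrite (disjointFl IJ kJ).
move=> IJ kJ fnd gnd.
move=> /(mixture_integrable t01)[fi fzi] /(mixture_integrable t01)[gi _].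
have fi' :
    P.-integrable setT (fun x : T => (f (coord_restr I (zeroing k x)))%:E).
  exact: (integrable_distribution P (zeroing k) (measurable_int _ fi)).1.
have [f' f'nd ff'] := coord_nondecreasing_zeroing k fnd.
apply: cov_le0_mixture => //.
- by apply/funext => x /=; rewrite coord_restr_zeroing.
- exact: NA.
- have -> : (fun x => f (coord_restr I x)) \o zeroing k =
      fun x => f' (coord_restr I x) by exact/funext.
  apply: NA => //.
  by move: fi'; under eq_fun do rewrite ff'.
Qed.

End association.

(* [set_type A] carries the subspace topology. *)
Theorem theorem3 (R : realType) (n : nat) :
  [/\ path_connected R
        (set_type (@negatively_correlated R n `&` @on_boolean_cube R n)),
      path_connected R
        (set_type (@negatively_associated R n `&` @on_boolean_cube R n)),
      path_connected R (set_type (@negatively_correlated R n)) &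
      path_connected R (set_type (@negatively_associated R n))].
Proof.
have nc0 := @negatively_correlated_dirac0 R n.
have na0 := @negatively_associated_dirac0 R n.
have cube0 := @on_boolean_cube_dirac0 R n.
have ncS := @negatively_correlated_stable R n.
have naS := @negatively_associated_stable R n.
have cubeS := @on_boolean_cube_stable R n.
by split; apply: zeroing_stable_path_connected => //; exact: zeroing_stableI.
Qed.
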